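(* Let $q\in[1,\infty)$ and $p\in(q,\infty]$. Then $\ell_p$ does not embed coarsely into any $q$-barycentric metric space.
   Context: For a set $\Omega$, let $\mathscr{P}^{<\infty}_\Omega$ be the set of finitely supported probability measures on $\Omega$. A barycenter map is a function $\mathfrak{B}:\mathscr{P}^{<\infty}_\Omega\to\Omega$ with $\mathfrak{B}(\delta_x)=x$ for all $x\in\Omega$. For $q\in[1,\infty)$ and $\beta\in(0,\infty)$, a metric space $(X,d_X)$ is $q$-barycentric with constant $\beta$ if there is a barycenter map $\mathfrak{B}:\mathscr{P}^{<\infty}_X\to X$ such that for every $x\in X$ and $\mu\in\mathscr{P}^{<\infty}_X$, $d_X(\mathfrak{B}(\mu),x)^q+\beta^{-q}\int_X d_X(\mathfrak{B}(\mu),y)^q\,d\mu(y)\le \int_X d_X(x,y)^q\,d\mu(y)$; it is $q$-barycentric if this holds for some $\beta$. A metric space $(Y,d_Y)$ embeds coarsely into $(X,d_X)$ if there exist nondecreasing $\omega,\Omega:[0,\infty)\to[0,\infty)$ with $\omega\le\Omega$ pointwise and $\lim_{t\to\infty}\omega(t)=\infty$, and a map $f:Y\to X$ with $\omega(d_Y(x,y))\le d_X(f(x),f(y))\le\Omega(d_Y(x,y))$ for all $x,y\in Y$. *)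

(* Defs.v *)
From Stdlib Require Import Reals Lra List Classical ClassicalEpsilon.
Open Scope R_scope.

(* Real power with the convention 0^r = 0 (Stdlib's Rpower 0 r = 1). *)
Definition rpow (x r : R) : R := if Rle_dec x 0 then 0 else Rpower x r.

Inductive exr : Type := Fin (r : R) | Inf.

Definition exr_gt (p : exr) (q : R) : Prop :=
  match p with Fin r => q < r | Inf => True end.

(* Supremum of a set of reals (meaningful when the set is nonempty and bounded). *)
Definition sup_R (E : R -> Prop) : R := epsilon (inhabits 0) (fun m => is_lub E m).

Definition lp_partial (p : R) (x y : nat -> R) : R -> Prop :=
  fun t => exists n, t = sum_f_R0 (fun k => rpow (Rabs (x k - y k)) p) n.

Definition lp_absset (x y : nat -> R) : R -> Prop :=
  fun t => exists n, t = Rabs (x n - y n).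

Definition lp_mem (p : exr) (x : nat -> R) : Prop :=
  match p with
  | Fin r => bound (lp_partial r x (fun _ => 0))
  | Inf => bound (lp_absset x (fun _ => 0))
  end.

(* The l_p distance: (sum |x_n - y_n|^p)^(1/p), resp. sup |x_n - y_n|.
   The series of nonnegative terms is summed as the sup of its partial sums. *)
Definition lp_dist (p : exr) (x y : nat -> R) : R :=
  match p with
  | Fin r => rpow (sup_R (lp_partial r x y)) (/ r)
  | Inf => sup_R (lp_absset x y)
  end.

Definition lp_space (p : exr) : Type := { x : nat -> R | lp_mem p x }.

Definition lp_d (p : exr) (x y : lp_space p) : R := lp_dist p (proj1_sig x) (proj1_sig y).

Definition is_metric {X : Type} (d : X -> X -> R) : Prop :=
  (forall x y, 0 <= d x y) /\
  (forall x y, d x y = 0 <-> x = y) /\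
  (forall x y, d x y = d y x) /\
  (forall x y z, d x z <= d x y + d y z).

Definition sum_list (l : list R) : R := fold_right Rplus 0 l.

Definition fin_supp_prob {X : Type} (mu : X -> R) : Prop :=
  (forall x, 0 <= mu x) /\
  exists s : list X, NoDup s /\ (forall x, mu x <> 0 -> In x s) /\
                     sum_list (map mu s) = 1.

Definition fpm (X : Type) : Type := { mu : X -> R | fin_supp_prob mu }.

Definition fpm_supp {X : Type} (mu : fpm X) : list X :=
  proj1_sig (constructive_indefinite_description _ (proj2 (proj2_sig mu))).

Definition integ {X : Type} (mu : fpm X) (f : X -> R) : R :=
  sum_list (map (fun y => proj1_sig mu y * f y) (fpm_supp mu)).

(* Barycenter map: B(delta_x) = x (mu x = 1 characterises mu = delta_x). *)
Definition is_barycenter_map {X : Type} (B : fpm X -> X) : Prop :=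
  forall (mu : fpm X) (x : X), proj1_sig mu x = 1 -> B mu = x.

Definition q_barycentric_with (q beta : R) (X : Type) (d : X -> X -> R) : Prop :=
  exists B : fpm X -> X, is_barycenter_map B /\
    forall (x : X) (mu : fpm X),
      rpow (d (B mu) x) q + / rpow beta q * integ mu (fun y => rpow (d (B mu) y) q)
      <= integ mu (fun y => rpow (d x y) q).

Definition q_barycentric (q : R) (X : Type) (d : X -> X -> R) : Prop :=
  exists beta, 0 < beta /\ q_barycentric_with q beta X d.

Definition nondecr_nonneg (w : R -> R) : Prop :=
  (forall t, 0 <= t -> 0 <= w t) /\ (forall s t, 0 <= s -> s <= t -> w s <= w t).

Definition coarse_embeds {Y X : Type} (dY : Y -> Y -> R) (dX : X -> X -> R) : Prop :=
  exists (om Om : R -> R) (f : Y -> X),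
    nondecr_nonneg om /\ nondecr_nonneg Om /\
    (forall t, 0 <= t -> om t <= Om t) /\
    (forall M, exists T, forall t, T <= t -> M <= om t) /\
    (forall x y, om (dY x y) <= dX (f x) (f y) /\ dX (f x) (f y) <= Om (dY x y)).

(* Main.v *)
Require Import Defs.
From Stdlib Require Import Reals Lra List Classical ClassicalEpsilon.
From HB Require Import structures.
From mathcomp Require Import all_boot all_algebra zify.
Open Scope R_scope.
Delimit Scope ring_scope with G.

(** Put [D := d^q].  Applied to two-point measures, the barycenter gives a
    midpoint with [D(mid a b, z) + c D(a, b) <= (D(a, z) + D(b, z)) / 2].
    For [f : G -> X] on the torus [G = (Z/4k)^n], let [g_i] be [f] with its last
    coordinates successively replaced by midpoints of the values at [x + e_j]
    and [x - e_j].  Averaging over [x] and telescoping yields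
    [c * sum_i E D(g_i(x + e_i), g_i(x - e_i)) <= E D(f(x + eps), f(x)) <= K^q],
    where [K] bounds [d(f(x + eps), f(x))] for [eps] in [{-1,0,1}^n].  Each [g_i]
    is [K]-close to [f], so if [d(f(x + 2k e_i), f(x)) >= A + 2K] always, walking
    [k] steps of length 2 and convexity bound every summand below by [(A/k)^q];
    hence [c n (A/k)^q <= K^q], i.e. [c A^q <= K^q] once [n >= k^q] (sharp metric
    cotype [q]).  Triangle waves scaled by [s ~ n^(-1/p)] map the torus to [l_p]
    with [eps]-steps of length at most 1 and antipodal distance at least
    [s k ~ k^(1 - q/p)], which is unbounded, so a coarse embedding would let [A]
    be arbitrarily large. *)

(** * Real powers with [0^r = 0] *)

Lemma rpow_ge0 x r : 0 <= rpow x r.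
Proof. unfold rpow; destruct (Rle_dec x 0); [lra | apply Rlt_le, exp_pos]. Qed.

Lemma rpow_pos x r : 0 < x -> rpow x r = Rpower x r.
Proof. intros hx; unfold rpow; destruct (Rle_dec x 0); [lra | reflexivity]. Qed.

Lemma rpow_gt0 x r : 0 < x -> 0 < rpow x r.
Proof. intros hx; rewrite rpow_pos //; apply exp_pos. Qed.

Lemma rpow0 r : rpow 0 r = 0.
Proof. unfold rpow; destruct (Rle_dec 0 0); [reflexivity | lra]. Qed.

Lemma rpow_le x y r : 0 < r -> x <= y -> rpow x r <= rpow y r.
Proof.
intros hr hxy; destruct (Rle_dec x 0) as [hx | hx].
  replace (rpow x r) with 0 by (unfold rpow; destruct (Rle_dec x 0); lra).
  apply rpow_ge0.
rewrite !rpow_pos; try lra.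
apply Rle_Rpower_l; lra.
Qed.

Lemma rpow_lt x y r : 0 < r -> 0 <= x -> x < y -> rpow x r < rpow y r.
Proof.
intros hr hx hxy; destruct hx as [hx | <-].
  rewrite !rpow_pos; try lra; apply Rlt_Rpower_l; lra.
rewrite rpow0; apply rpow_gt0; lra.
Qed.

Lemma rpow_le_inv x y r : 0 < r -> 0 <= y -> rpow x r <= rpow y r -> x <= y.
Proof.
intros hr hy h; destruct (Rle_dec x y) as [|n]; [assumption|].
pose proof (rpow_lt y x r hr hy ltac:(lra)); lra.
Qed.

Lemma rpow_mult x y r : 0 <= x -> 0 <= y -> rpow (x * y) r = rpow x r * rpow y r.
Proof.
intros [hx | <-] [hy | <-]; rewrite ?Rmult_0_l ?Rmult_0_r ?rpow0; try ring.
rewrite !rpow_pos //; last by apply Rmult_lt_0_compat.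
by rewrite Rpower_mult_distr.
Qed.

Lemma rpow_rpow x r s : 0 <= x -> rpow (rpow x r) s = rpow x (r * s).
Proof.
intros [hx | <-]; last by rewrite !rpow0.
rewrite (rpow_pos x) // (rpow_pos x) // rpow_pos; last by apply exp_pos.
apply Rpower_mult.
Qed.

Lemma rpow_1 x : 0 <= x -> rpow x 1 = x.
Proof. intros [hx | <-]; [rewrite rpow_pos // Rpower_1 // | apply rpow0]. Qed.

(* Bernoulli's inequality [1 + q (y - 1) <= y^q] at [y = a / t]; it comes from
   [y^q = y exp ((q - 1) ln y)] and [1 - 1 / y <= ln y]. *)
Lemma rpow_tangent q t a : 1 <= q -> 0 < t -> 0 <= a ->
  rpow t q + q * (rpow t q / t) * (a - t) <= rpow a q.
Proof.
intros hq ht ha.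
have hB y : 0 < y -> 1 + q * (y - 1) <= Rpower y q.
{ intros hy.
  have h1 := exp_ineq1_le ((q - 1) * ln y).
  have h2 := exp_ineq1_le (- ln y).
  have h3 : Rpower y q = y * exp ((q - 1) * ln y).
    by rewrite -[in RHS](exp_ln y hy) -exp_plus ln_exp /Rpower; congr exp; ring.
  rewrite exp_Ropp exp_ln // in h2.
  have h4 : y * / y = 1 by field; lra.
  have h5 : y - 1 <= y * ln y by nra.
  rewrite h3; nra. }
have htq : 0 < rpow t q by apply rpow_gt0.
destruct ha as [ha | <-].
  have hy : 0 < a / t by apply Rdiv_lt_0_compat.
  replace a with (t * (a / t)) at 2 by (field; lra).
  rewrite rpow_mult; try lra.
  rewrite (rpow_pos (a / t)) //.
  have := hB _ hy => h.
  apply (Rmult_le_compat_l (rpow t q)) in h; [| lra].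
  replace (rpow t q + q * (rpow t q / t) * (a - t))
    with (rpow t q * (1 + q * (a / t - 1))) by (field; lra).
  exact h.
rewrite rpow0.
replace (rpow t q + q * (rpow t q / t) * (0 - t)) with (rpow t q * (1 - q)) by (field; lra).
nra.
Qed.

(** * Two-point measures and midpoints *)

Definition indic {X : Type} (a x : X) : R :=
  if excluded_middle_informative (x = a) then 1 else 0.

Lemma indic_diag {X : Type} (a : X) : indic a a = 1.
Proof. by rewrite /indic; case: excluded_middle_informative. Qed.

Lemma indic_neq {X : Type} (a x : X) : x <> a -> indic a x = 0.
Proof. by rewrite /indic; case: excluded_middle_informative. Qed.

Lemma indic_ge0 {X : Type} (a x : X) : 0 <= indic a x.
Proof. rewrite /indic; destruct (excluded_middle_informative (x = a)) => /=; lra. Qed.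

Lemma sum_list_indic_notin {X : Type} (a : X) (F : X -> R) s :
  ~ In a s -> sum_list (List.map (fun y => indic a y * F y) s) = 0.
Proof.
elim: s => [|b s IH] //= h.
rewrite indic_neq; last by move=> e; apply: h; left.
rewrite IH; [ring | by move=> hs; apply: h; right].
Qed.

Lemma sum_list_indic {X : Type} (a : X) (F : X -> R) s :
  NoDup s -> In a s -> sum_list (List.map (fun y => indic a y * F y) s) = F a.
Proof.
elim: s => [|b s IH] //= /NoDup_cons_iff [hb hs] [e | h].
  by rewrite e in hb *; rewrite indic_diag sum_list_indic_notin //; ring.
rewrite indic_neq; last by move=> e; apply: hb; rewrite e.
by rewrite IH //; ring.
Qed.

Definition two_point {X : Type} (a b x : X) : R := (indic a x + indic b x) / 2.

Lemma two_point_sum {X : Type} (a b : X) (F : X -> R) s :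
  NoDup s -> In a s -> In b s ->
  sum_list (List.map (fun y => two_point a b y * F y) s) = (F a + F b) / 2.
Proof.
move=> hs ha hb; rewrite -(sum_list_indic a F s) // -(sum_list_indic b F s) //.
elim: s {hs ha hb} => [|c s IH] /=; first by field.
by rewrite IH /two_point; field.
Qed.

Lemma two_point_prob {X : Type} (a b : X) : fin_supp_prob (two_point a b).
Proof.
split=> [x|].
  have := indic_ge0 a x; have := indic_ge0 b x; rewrite /two_point; lra.
have [s [hs [ha hb]]] : exists s : list X, NoDup s /\ In a s /\ In b s.
  (* The support list must be free of duplicates, which sets the case [a = b] apart. *)
  case: (classic (a = b)) => [->|hab].
    exists (b :: nil)%list; split; last by split; left.
    by constructor=> //; constructor.
  exists (a :: b :: nil)%list; split.
    by constructor; [case=> // e; apply: hab | constructor=> //; constructor].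
  by split; [left | right; left].
exists s; split=> //; split=> [x hx|].
  apply: NNPP => hn; apply: hx; rewrite /two_point !indic_neq; first by field.
    by move=> e; apply: hn; rewrite e.
  by move=> e; apply: hn; rewrite e.
rewrite -[RHS](_ : (1 + 1) / 2 = 1); last by field.
rewrite -(two_point_sum a b (fun=> 1) s) //.
by congr sum_list; apply: List.map_ext => y; rewrite Rmult_1_r.
Qed.

Definition two_pointP {X : Type} (a b : X) : fpm X := exist _ _ (two_point_prob a b).

(** [fpm_supp] is an unspecified list, but it contains every point of nonzero mass, hence [a] and
    [b], and [two_point_sum] gives the same value for every such list. *)
Lemma integ_two_point {X : Type} (a b : X) (F : X -> R) :
  integ (two_pointP a b) F = (F a + F b) / 2.
Proof.
rewrite /integ /fpm_supp; case: constructive_indefinite_description => s /= [hs [hin _]].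
apply: two_point_sum => //; apply: hin; rewrite /two_point indic_diag.
  have := indic_ge0 b a; lra.
have := indic_ge0 a b; lra.
Qed.

(** [x + y] is at most twice the larger of the two. *)
Lemma rpow_sum_le q x y : 1 <= q -> 0 <= x -> 0 <= y ->
  rpow (x + y) q <= rpow 2 q * (rpow x q + rpow y q).
Proof.
move=> hq hx hy; have h2 := rpow_ge0 2 q.
have hx' := rpow_ge0 x q; have hy' := rpow_ge0 y q.
case: (Rle_dec x y) => h.
  apply: (Rle_trans _ (rpow (2 * y) q)); first by apply: rpow_le; lra.
  rewrite rpow_mult; try lra; nra.
apply: (Rle_trans _ (rpow (2 * x) q)); first by apply: rpow_le; lra.
rewrite rpow_mult; try lra; nra.
Qed.

(** The midpoint [m] is the barycenter of the two-point measure; the triangle inequality gives [d(m,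
    a)^q + d(m, b)^q >= 2^(-q) d(a, b)^q] for the integral term. *)
Lemma barycentric_midpoint q (X : Type) (d : X -> X -> R) :
  1 <= q -> is_metric d -> q_barycentric q X d ->
  exists (c : R) (mid : X -> X -> X), 0 < c /\ forall a b z,
    rpow (d (mid a b) z) q + c * rpow (d a b) q
      <= (rpow (d a z) q + rpow (d b z) q) / 2.
Proof.
move=> hq [d0 [_ [dC dT]]] [beta [hbeta [B [_ hB]]]].
have hb : 0 < / rpow beta q by apply/Rinv_0_lt_compat/rpow_gt0.
have h2 : 0 < / rpow 2 q by apply/Rinv_0_lt_compat/rpow_gt0; lra.
exists (/ rpow beta q * / rpow 2 q / 2), (fun a b => B (two_pointP a b)).
split=> [|a b z]; first by nra.
have := hB z (two_pointP a b); rewrite !integ_two_point.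
set m := B _; rewrite (dC z a) (dC z b) => h.
suff : / rpow 2 q * rpow (d a b) q <= rpow (d m a) q + rpow (d m b) q by nra.
have h3 : rpow (d a b) q <= rpow 2 q * (rpow (d m a) q + rpow (d m b) q).
  apply: Rle_trans (rpow_sum_le _ _ _ hq (d0 _ _) (d0 _ _)).
  by apply: rpow_le; [lra | rewrite (dC m a); apply: dT].
apply: (Rmult_le_reg_l (rpow 2 q)); first by apply: rpow_gt0; lra.
rewrite -Rmult_assoc Rinv_r ?Rmult_1_l //.
by apply: Rgt_not_eq; apply: rpow_gt0; lra.
Qed.

(** * Sums over a finite abelian group *)

HB.instance Definition _ := Monoid.isComLaw.Build R 0 Rplus
  (fun x y z => esym (Rplus_assoc x y z)) Rplus_comm Rplus_0_l.

Section GroupSum.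
Variable G : finZmodType.

(** Averages over the group appear as unnormalised sums, compared with multiples of [gcard]. *)
Definition gsum (F : G -> R) : R := \big[Rplus/0]_(x : G) F x.

Lemma gsum_shift (v : G) F : gsum (fun x => F (x + v)%G) = gsum F.
Proof.
rewrite /gsum [RHS](reindex_inj (h := fun x => (x + v)%G)) //.
exact: GRing.addIr.
Qed.

Lemma eq_gsum F F' : (forall x, F x = F' x) -> gsum F = gsum F'.
Proof. by move=> h; apply: eq_bigr => x _. Qed.

Lemma gsumD F F' : gsum (fun x => F x + F' x) = gsum F + gsum F'.
Proof. exact: big_split. Qed.

Lemma gsumM c F : gsum (fun x => c * F x) = c * gsum F.
Proof.
by rewrite /gsum; elim/big_rec2: _ => [|x y1 y2 _ ->]; ring.
Qed.

Lemma gsum_le F F' : (forall x, F x <= F' x) -> gsum F <= gsum F'.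
Proof.
by move=> h; rewrite /gsum; elim/big_ind2: _ => [|*|x _ //]; [lra | apply: Rplus_le_compat].
Qed.

Definition gcard : R := gsum (fun=> 1).

Lemma gsum_cst c : gsum (fun=> c) = c * gcard.
Proof. by rewrite -gsumM; apply: eq_gsum => x; ring. Qed.

Lemma gcard_gt0 : 0 < gcard.
Proof.
rewrite /gcard /gsum (bigD1 (0%G : G)) //=.
set S := bigop.body _ _ _; suff : 0 <= S by rewrite /=; lra.
by rewrite /S; elim/big_ind: _ => * /=; lra.
Qed.

End GroupSum.

(** * Iterated midpoints and the cotype inequality *)

(** The sums of [eps_j v_j] with each [eps_j] in [{-1, 0, 1}]. *)
Fixpoint signed_sum {G : zmodType} (vs : seq G) (s : G) : Prop :=
  if vs is v :: us then
    exists t, signed_sum us t /\ (s = t \/ s = (t + v)%G \/ s = (t - v)%G)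
  else s = 0%G.

(** On the suffixes of a list of basis vectors these are the functions [g_i]. *)
Fixpoint iter_mid {X : Type} (mid : X -> X -> X) {G : zmodType} (f : G -> X)
    (vs : seq G) : G -> X :=
  if vs is v :: us then
    fun x => mid (iter_mid mid f us (x + v)%G) (iter_mid mid f us (x - v)%G)
  else f.

Section Cotype.
Variables (q c : R) (X : Type) (d : X -> X -> R) (mid : X -> X -> X).
Hypotheses (hq : 1 <= q) (hd : is_metric d) (hc : 0 < c).
Hypothesis hmid : forall a b z,
  rpow (d (mid a b) z) q + c * rpow (d a b) q
    <= (rpow (d a z) q + rpow (d b z) q) / 2.
Variable G : finZmodType.
Implicit Types (f g h : G -> X) (v x s : G) (vs : seq G).

(** Closed balls are stable under midpoints: the mean of two [q]-th powers below [K^q] is below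
    [K^q]. *)
Lemma mid_le a b z K : 0 <= K -> d a z <= K -> d b z <= K -> d (mid a b) z <= K.
Proof.
move=> hK ha hb; apply: (rpow_le_inv _ _ q) => //; first by lra.
have h1 : rpow (d a z) q <= rpow K q by apply: rpow_le; lra.
have h2 : rpow (d b z) q <= rpow K q by apply: rpow_le; lra.
have h3 := hmid a b z; have h4 := rpow_ge0 (d a b) q; nra.
Qed.

Lemma iter_mid_le f vs x z K : 0 <= K ->
  (forall s, signed_sum vs s -> d (f (x + s)%G) z <= K) ->
  d (iter_mid mid f vs x) z <= K.
Proof.
move=> hK; elim: vs x => [|v vs IH] x /= h.
  by have := h 0%G erefl; rewrite GRing.addr0.
apply: mid_le => //; apply: IH => s hs.
  rewrite -GRing.addrA (GRing.addrC v); apply: h.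
  by exists s; split=> //; right; left.
rewrite -GRing.addrA (GRing.addrC (- v)%G); apply: h.
by exists s; split=> //; right; right.
Qed.

(** Triangle inequality along [k] steps; by translation invariance all steps contribute the same
    sum. *)
Lemma gsum_iter_dist g v k :
  gsum _ (fun x => d (g (x + v *+ k)%G) (g x))
    <= INR k * gsum _ (fun x => d (g (x + v)%G) (g x)).
Proof.
have [d0 [d1 [dC dT]]] := hd.
elim: k => [|k IH].
  rewrite /= Rmult_0_l (eq_gsum _ _ (fun=> 0)); first by rewrite gsum_cst; lra.
  by move=> x; rewrite GRing.mulr0n GRing.addr0; apply/d1.
rewrite S_INR Rmult_plus_distr_r Rmult_1_l.
apply: (Rle_trans _ (gsum _ (fun x => d (g (x + v + v *+ k)%G) (g (x + v)%G)
                                      + d (g (x + v)%G) (g x)))).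
  by apply: gsum_le => x; rewrite GRing.mulrS GRing.addrA; apply: dT.
by rewrite gsumD (gsum_shift _ v (fun x => d (g (x + v *+ k)%G) (g x))); lra.
Qed.

(** Passing from [f] to [g] costs [2 * K], so [k] steps by [2v] cover at least [A], and the mean
    step is at least [A / k]. Convexity carries this over to [q]-th powers. *)
Lemma gsum_edge_ge f g v k A K : (0 < k)%N -> 0 < A ->
  (forall x, d (g x) (f x) <= K) ->
  (forall x, A + 2 * K <= d (f (x + v *+ 2 *+ k)%G) (f x)) ->
  rpow (A / INR k) q * gcard G
    <= gsum _ (fun x => rpow (d (g (x + v)%G) (g (x - v)%G)) q).
Proof.
move=> hk hA hgf hf; have [d0 [d1 [dC dT]]] := hd.
have hk' : 0 < INR k by apply: lt_0_INR; apply/ltP.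
set t := A / INR k.
have ht : 0 < t by apply: Rdiv_lt_0_compat.
have -> : gsum _ (fun x => rpow (d (g (x + v)%G) (g (x - v)%G)) q)
        = gsum _ (fun x => rpow (d (g (x + v *+ 2)%G) (g x)) q).
  rewrite -(gsum_shift _ v); apply: eq_gsum => x.
  by rewrite GRing.addrK GRing.mulr2n GRing.addrA.
have hsum : A * gcard G <= INR k * gsum _ (fun x => d (g (x + v *+ 2)%G) (g x)).
  apply: Rle_trans (gsum_iter_dist _ _ _); rewrite -gsum_cst.
  apply: gsum_le => x; set y := (x + _)%G.
  have h1 := hf x; have h2 := hgf x; have h3 := hgf y.
  have h4 := dT (f y) (g y) (f x); have h5 := dT (g y) (g x) (f x).
  by rewrite (dC (f y) (g y)) in h4; rewrite -/y in h1; lra.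
set S := gsum _ _ in hsum.
have hS : t * gcard G <= S.
  apply: (Rmult_le_reg_l (INR k)) => //.
  by rewrite -Rmult_assoc (_ : INR k * t = A) //; rewrite /t; field; lra.
set u := q * (rpow t q / t).
have hu : 0 <= u.
  apply: Rmult_le_pos; first by lra.
  by apply/Rlt_le/Rdiv_lt_0_compat => //; apply: rpow_gt0.
(* Jensen's inequality through the tangent line at [t], of slope [u]. *)
apply: (Rle_trans _ (gsum _ (fun x => (rpow t q - u * t) + u * d (g (x + v *+ 2)%G) (g x)))).
  rewrite gsumD gsumM gsum_cst -/S; nra.
apply: gsum_le => x; have := rpow_tangent q t _ hq ht (d0 (g (x + v *+ 2)%G) (g x)).
rewrite -/u; nra.
Qed.

(* Replacing [h] by its translates [h (x -+ v)] makes the averages over signs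
   telescope along [vs] without ever being written down. *)
Lemma gsum_iter_mid_le f h vs k A K M : (0 < k)%N -> 0 < A -> 0 <= K ->
  (forall x s, signed_sum vs s -> d (f (x + s)%G) (f x) <= K) ->
  (forall x v, v \in vs -> A + 2 * K <= d (f (x + v *+ 2 *+ k)%G) (f x)) ->
  (forall x s, signed_sum vs s -> rpow (d (f (x + s)%G) (h x)) q <= M) ->
  gsum _ (fun x => rpow (d (iter_mid mid f vs x) (h x)) q)
    + c * INR (size vs) * rpow (A / INR k) q * gcard G <= M * gcard G.
Proof.
move=> hk hA hK; elim: vs h => [|v vs IH] h hs hv hM.
  rewrite /= Rmult_0_r !Rmult_0_l Rplus_0_r -gsum_cst; apply: gsum_le => x.
  by have := hM x 0%G erefl; rewrite GRing.addr0.
have sub s : signed_sum vs s -> signed_sum (v :: vs) s.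
  by move=> ?; exists s; split=> //; left.
have hs' x s : signed_sum vs s -> d (f (x + s)%G) (f x) <= K by move/sub; apply: hs.
have hv' x w : w \in vs -> A + 2 * K <= d (f (x + w *+ 2 *+ k)%G) (f x).
  by move=> hw; apply: hv; rewrite inE hw orbT.
have h1 := IH (fun x => h (x - v)%G) hs' hv'.
have h2 := IH (fun x => h (x + v)%G) hs' hv'.
rewrite -(gsum_shift _ v (fun x => rpow (d (iter_mid mid f vs x) (h (x - v)%G)) q)) in h1.
rewrite -(gsum_shift _ (- v)%G (fun x => rpow (d (iter_mid mid f vs x) (h (x + v)%G)) q)) in h2.
set g := iter_mid mid f vs in h1 h2 *.
have h3 : rpow (A / INR k) q * gcard G
    <= gsum _ (fun x => rpow (d (g (x + v)%G) (g (x - v)%G)) q).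
  apply: (gsum_edge_ge f g v k A K) => // x.
    by apply: iter_mid_le => // s; apply: hs'.
  by apply: hv; rewrite inE eqxx.
have h4 : gsum _ (fun x => rpow (d (iter_mid mid f (v :: vs) x) (h x)) q)
   + c * gsum _ (fun x => rpow (d (g (x + v)%G) (g (x - v)%G)) q)
   <= / 2 * (gsum _ (fun x => rpow (d (g (x + v)%G) (h x)) q)
             + gsum _ (fun x => rpow (d (g (x - v)%G) (h x)) q)).
  rewrite -gsumM -!gsumD -gsumM; apply: gsum_le => x /=.
  by apply: (Rle_trans _ _ _ (hmid (g (x + v)%G) (g (x - v)%G) (h x))); lra.
have {}h1 : gsum _ (fun x => rpow (d (g (x + v)%G) (h x)) q)
    + c * INR (size vs) * rpow (A / INR k) q * gcard G <= M * gcard G.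
  rewrite (eq_gsum _ _ (fun x => rpow (d (g (x + v)%G) (h (x + v - v)%G)) q)); last first.
    by move=> x; rewrite GRing.addrK.
  apply: h1 => x s hsg.
  rewrite -{1}(GRing.subrK v x) -GRing.addrA (GRing.addrC v); apply: hM.
  by exists s; split=> //; right; left.
have {}h2 : gsum _ (fun x => rpow (d (g (x - v)%G) (h x)) q)
    + c * INR (size vs) * rpow (A / INR k) q * gcard G <= M * gcard G.
  rewrite (eq_gsum _ _ (fun x => rpow (d (g (x - v)%G) (h (x - v + v)%G)) q)); last first.
    by move=> x; rewrite GRing.subrK.
  apply: h2 => x s hsg.
  rewrite -{1}(GRing.addrK v x) -GRing.addrA (GRing.addrC (- v)%G); apply: hM.
  by exists s; split=> //; right; right.
(* The mean of [h1] and [h2] bounds the right side of [h4]; [c] times [h3] is the new term for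
   [v]. *)
rewrite [size _]/= S_INR; nra.
Qed.

(** The case [h = f], [M = K^q], after dropping a nonnegative sum and cancelling [gcard]. *)
Lemma midpoint_cotype f vs k A K : (0 < k)%N -> 0 < A -> 0 <= K ->
  (forall x s, signed_sum vs s -> d (f (x + s)%G) (f x) <= K) ->
  (forall x v, v \in vs -> A + 2 * K <= d (f (x + v *+ 2 *+ k)%G) (f x)) ->
  c * INR (size vs) * rpow (A / INR k) q <= rpow K q.
Proof.
move=> hk hA hK hs hv; apply: (Rmult_le_reg_r (gcard G)); first exact: gcard_gt0.
have := gsum_iter_mid_le f f vs k A K (rpow K q) hk hA hK hs hv.
move=> H; apply: Rle_trans (H _); last first.
  by move=> x s hsg; apply: rpow_le; [lra | apply: hs].
suff : 0 <= gsum G (fun x => rpow (d (iter_mid mid f vs x) (f x)) q) by lra.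
apply: Rle_trans (gsum_le _ (fun=> 0) _ _); first by rewrite gsum_cst; lra.
by move=> x; apply: rpow_ge0.
Qed.

End Cotype.

(** * Distances in [l_p] between sequences differing in finitely many coordinates *)

(** A member and an upper bound provide a least upper bound by completeness, so the [epsilon] in
    [sup_R] picks a genuine one. *)
Lemma sup_R_bounds (E : R -> Prop) e B :
  E e -> (forall t, E t -> t <= B) -> e <= sup_R E /\ sup_R E <= B.
Proof.
move=> he hB.
have [m hm] : exists m, is_lub E m.
  have [m hm] := completeness E (ex_intro _ B hB) (ex_intro _ e he).
  by exists m.
have [h1 h2] : is_lub E (sup_R E) by apply: epsilon_spec; exists m.
by split; [apply: h1 | apply: h2].
Qed.

Lemma sum_f_R0_ge_term u n : (forall k, 0 <= u k) -> u n <= sum_f_R0 u n.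
Proof.
move=> hu; case: n => [|n] /=; first exact: Rle_refl.
have := cond_pos_sum u n hu; lra.
Qed.

Lemma sum_f_R0_le_supp u n M B : 0 <= B -> (forall k, u k <= B) ->
  (forall k, (M <= k)%N -> u k = 0) -> sum_f_R0 u n <= INR M * B.
Proof.
move=> hB hu h0.
(* [sum_f_R0 u i] has [i + 1] terms, and at most [M] of them are nonzero. *)
have h i : sum_f_R0 u i <= INR (minn i.+1 M) * B.
  elim: i => [|i IH] /=.
    case: M h0 => [|M] h0; first by rewrite h0 //= ; lra.
    by have -> : minn 1 M.+1 = 1%N by [lia]; rewrite /= Rmult_1_l.
  case: (leqP M i.+1) => hM.
    rewrite h0 //; have e : minn i.+1 M = minn i.+2 M by lia.
    by rewrite -e; lra.
  have -> : minn i.+2 M = (minn i.+1 M).+1 by lia.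
  by rewrite S_INR; have := hu i.+1; lra.
apply: Rle_trans (h n) _; apply: Rmult_le_compat_r => //.
by apply: le_INR; apply/leP; lia.
Qed.

Section FiniteSupport.
Variables (p : exr) (M : nat) (B : R) (x y : nat -> R).
Hypothesis hp : exr_gt p 0.
Hypothesis hxy : forall N, Rabs (x N - y N) <= B.
Hypothesis hsupp : forall N, (M <= N)%N -> x N = y N.

Lemma lp_partial_le r t : 0 < r -> lp_partial r x y t -> t <= INR M * rpow B r.
Proof.
move=> hr [n ->]; apply: sum_f_R0_le_supp => [|k|k hk]; first exact: rpow_ge0.
  exact: rpow_le.
by rewrite hsupp // Rminus_diag Rabs_R0 rpow0.
Qed.

Lemma lp_absset_le t : lp_absset x y t -> t <= B.
Proof. by move=> [n ->]. Qed.

Lemma lp_dist_ge_coord N : Rabs (x N - y N) <= lp_dist p x y.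
Proof.
case: p hp => [r|] /= hr.
  set t := sum_f_R0 (fun k => rpow (Rabs (x k - y k)) r) N.
  have [h _] := sup_R_bounds (lp_partial r x y) t (INR M * rpow B r)
    (ex_intro _ N erefl) (fun t ht => lp_partial_le r t hr ht).
  have h1 : rpow (Rabs (x N - y N)) r <= t.
    apply: (sum_f_R0_ge_term (fun k => rpow (Rabs (x k - y k)) r)) => k.
    exact: rpow_ge0.
  rewrite -{1}(rpow_1 (Rabs (x N - y N)) (Rabs_pos _)).
  rewrite -(Rinv_r r); last lra.
  rewrite -rpow_rpow; last exact: Rabs_pos.
  by apply: rpow_le; [apply: Rinv_0_lt_compat | lra].
by have [h _] := sup_R_bounds (lp_absset x y) _ B (ex_intro _ N erefl) lp_absset_le.
Qed.

Lemma lp_dist_le1 :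
  match p with Fin r => INR M * rpow B r <= 1 | Inf => B <= 1 end ->
  lp_dist p x y <= 1.
Proof.
case: p hp => [r|] /= hr hM.
  have [_ h] := sup_R_bounds (lp_partial r x y) _ (INR M * rpow B r)
    (ex_intro _ 0%N erefl) (fun t ht => lp_partial_le r t hr ht).
  apply: (Rle_trans _ (rpow 1 (/ r))).
    by apply: rpow_le; [apply: Rinv_0_lt_compat | lra].
  by rewrite rpow_pos ?/Rpower ?ln_1 ?Rmult_0_r ?exp_0; lra.
have [_ h] := sup_R_bounds (lp_absset x y) _ B (ex_intro _ 0%N erefl) lp_absset_le.
lra.
Qed.

End FiniteSupport.

Lemma finsupp_lp_mem p M B x : exr_gt p 0 ->
  (forall N, Rabs (x N) <= B) -> (forall N, (M <= N)%N -> x N = 0) -> lp_mem p x.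
Proof.
move=> hp hx h0.
have hx' N : Rabs (x N - 0) <= B by rewrite Rminus_0_r.
case: p hp => [r|] /= hr.
  by exists (INR M * rpow B r) => t; apply: (lp_partial_le M B).
by exists B => t; apply: lp_absset_le.
Qed.

(** * Choice of side length, dimension and scale *)

Lemma nat_ceil x : 0 <= x -> exists n : nat, x <= INR n <= x + 1.
Proof.
move=> hx; have [h1 h2] := archimed x.
have hz : BinInt.Z.le 0 (up x) by apply: le_IZR; lra.
exists (BinInt.Z.to_nat (up x)); rewrite INR_IZR_INZ Znat.Z2Nat.id //; lra.
Qed.

(** For finite [p], take [k^q <= n <= k^q + 1], so [2n <= 4 k^q], and [s = (4 k^q)^(-1/p)]. Then
    [s k = 4^(-1/p) k^(1 - q/p)] exceeds [T] for large [k]. For [p = Inf], [s = 1] suffices. The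
    factor [n.*2] counts the coordinates used in [l_p]. *)
Lemma exists_scale q p T : 1 <= q -> exr_gt p q ->
  exists (k n : nat) (s : R), [/\ (0 < k)%N, rpow (INR k) q <= INR n, 0 < s,
    match p with Fin r => INR n.*2 * rpow s r <= 1 | Inf => s <= 1 end
    & T <= s * INR k].
Proof.
move=> hq; case: p => [r|] /= hr; last first.
  have [k [hk _]] := nat_ceil (Rmax T 1) ltac:(have := Rmax_r T 1; lra).
  have := Rmax_l T 1; have := Rmax_r T 1 => hT1 hT.
  have [n [hn _]] := nat_ceil (rpow (INR k) q) (rpow_ge0 _ _).
  exists k, n, 1; split=> //; try lra.
  by apply/ltP; apply: INR_lt; rewrite /=; lra.
have hqr : q / r < 1 by apply/(Rmult_lt_reg_r r); [lra | field_simplify; lra].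
set e := 1 - q / r; have he : 0 < e by rewrite /e; lra.
set c := Rpower 4 (- / r); have hc : 0 < c by apply: exp_pos.
(* The maximum with 1 keeps the base of [Rpower] positive even when [T <= 0]. *)
set U := Rmax (T / c) 1; have hU1 : 1 <= U by apply: Rmax_r.
have hUT : T / c <= U by apply: Rmax_l.
have hV : 1 <= Rmax 1 (Rpower U (/ e)) by apply: Rmax_l.
have [k [hk _]] := nat_ceil (Rmax 1 (Rpower U (/ e))) ltac:(lra).
have hk1 : 1 <= INR k by lra.
have hkU : Rpower U (/ e) <= INR k by have := Rmax_r 1 (Rpower U (/ e)); lra.
have [n [hn1 hn2]] := nat_ceil (rpow (INR k) q) (rpow_ge0 _ _).
rewrite rpow_pos in hn1 hn2; last lra.
have hkq : 1 <= Rpower (INR k) q.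
  by rewrite -(Rpower_O (INR k)); [apply: Rle_Rpower; lra | lra].
exists k, n, (c * Rpower (INR k) (- (q / r))); split.
- by apply/ltP; apply: INR_lt; rewrite /=; lra.
- by rewrite rpow_pos //; lra.
- by apply: Rmult_lt_0_compat => //; apply: exp_pos.
- rewrite rpow_pos; last by apply: Rmult_lt_0_compat => //; apply: exp_pos.
  rewrite -Rpower_mult_distr //; last exact: exp_pos.
  rewrite /c !Rpower_mult.
  have -> : - / r * r = - (1) by field; lra.
  have -> : - (q / r) * r = - q by field; lra.
  rewrite !Rpower_Ropp Rpower_1; last lra.
  rewrite -addnn plus_INR.
  have h := Rinv_r (Rpower (INR k) q) ltac:(lra).
  have h0 : 0 < / Rpower (INR k) q by apply: Rinv_0_lt_compat; lra.
  nra.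
rewrite Rmult_assoc -{2}(Rpower_1 (INR k)); last lra.
rewrite -Rpower_plus (_ : - (q / r) + 1 = e); last by rewrite /e; ring.
have h1 : U <= Rpower (INR k) e.
  rewrite -(Rpower_1 U); last lra.
  rewrite -(Rinv_l e); last lra.
  rewrite -Rpower_mult; apply: Rle_Rpower_l; first lra.
  by split=> //; apply: exp_pos.
have -> : T = c * (T / c) by field; lra.
by apply: Rmult_le_compat_l; lra.
Qed.

(** * Triangle waves of period [4k] *)

(** This is [|t - 2k|], in a form safe for truncated subtraction. *)
Definition triangle (k t : nat) : nat := (maxn t k.*2 - minn t k.*2)%N.

(* The pair [wave k false, wave k true] replaces the planar circle: at every
   point one of the two phases moves by at least [k] under the antipodal map. *)
Definition wave (k : nat) (b : bool) (t : nat) : nat :=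
  triangle k ((t + b * k) %% (4 * k)).

Lemma modnD_small P a b : (a < P)%N -> (b <= P)%N ->
  ((a + b) %% P = if a + b < P then a + b else a + b - P)%N.
Proof.
move=> ha hb; case: ltnP => h; first exact: modn_small.
by rewrite -{1}(subnK h) modnDr modn_small //; lia.
Qed.

Lemma wave_mod k b t : wave k b (t %% (4 * k)) = wave k b t.
Proof. by rewrite /wave modnDml. Qed.

Lemma wave_le k b t : (0 < k)%N -> (wave k b t <= 2 * k)%N.
Proof.
move=> hk; rewrite /wave /triangle.
have : ((t + b * k) %% (4 * k) < 4 * k)%N by rewrite ltn_mod; lia.
lia.
Qed.

(** [|t - 2k|] equals [2k] at both [0] and [4k], so wrapping around causes no jump. *)
Lemma wave_step k b t : (0 < k)%N ->
  (wave k b t.+1 <= wave k b t + 1)%N /\ (wave k b t <= wave k b t.+1 + 1)%N.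
Proof.
move=> hk; rewrite /wave.
have -> : (t.+1 + b * k)%N = (t + b * k + 1)%N by lia.
rewrite -modnDml; set r := ((t + b * k) %% _)%N.
have hr : (r < 4 * k)%N by rewrite ltn_mod; lia.
rewrite modnD_small //; last lia.
rewrite /triangle; case: ltnP; lia.
Qed.

(** For [r < 2k] the antipodal values [2k - r] and [r] differ by less than [k] only if [r] is within
    [k/2] of [k]; likewise around [3k]. Shifting by [k] moves such an [r] near [2k] or [0], where
    they differ by at least [k]. *)
Lemma wave_antipode k t : (0 < k)%N ->
  exists b, (wave k b t + k <= wave k b (t + 2 * k))%N
         \/ (wave k b (t + 2 * k) + k <= wave k b t)%N.
Proof.
move=> hk; rewrite /wave.
set r := (t %% (4 * k))%N.
have hr : (r < 4 * k)%N by rewrite ltn_mod; lia.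
have E c : ((t + c) %% (4 * k) = (r + c) %% (4 * k))%N by rewrite modnDml.
have [h | h] : (triangle k r + k <= triangle k ((r + 2 * k) %% (4 * k))
     \/ triangle k ((r + 2 * k) %% (4 * k)) + k <= triangle k r)%N \/
   (triangle k ((r + k) %% (4 * k)) + k <= triangle k ((r + 3 * k) %% (4 * k))
     \/ triangle k ((r + 3 * k) %% (4 * k)) + k <= triangle k ((r + k) %% (4 * k)))%N.
  move: r hr {E} => r hr.
  rewrite !modnD_small; try lia.
  by rewrite /triangle; do 3 (case: ltnP => ?); lia.
- by exists false; rewrite mul0n !addn0 E.
- exists true; rewrite mul1n -addnA !E.
  by have -> : (2 * k + k = 3 * k)%N by lia.
Qed.

Lemma Rabs_scaled_nat_le s a b : 0 < s -> (a <= b + 1)%N /\ (b <= a + 1)%N ->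
  Rabs (s * INR a - s * INR b) <= s.
Proof.
move=> hs [/leP/le_INR h1 /leP/le_INR h2]; rewrite !plus_INR /= in h1 h2.
rewrite -Rmult_minus_distr_l Rabs_mult (Rabs_right s); last lra.
rewrite -[X in _ <= X]Rmult_1_r; apply: Rmult_le_compat_l; first lra.
by apply: Rabs_le; lra.
Qed.

Lemma Rabs_scaled_nat_ge s k a b : 0 < s -> (b + k <= a)%N \/ (a + k <= b)%N ->
  s * INR k <= Rabs (s * INR a - s * INR b).
Proof.
move=> hs h; rewrite -Rmult_minus_distr_l Rabs_mult (Rabs_right s); last lra.
apply: Rmult_le_compat_l; first lra.
have hk := pos_INR k.
case: h => /leP/le_INR; rewrite plus_INR => h.
  by rewrite Rabs_right; lra.
by rewrite Rabs_left1; lra.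
Qed.

(** * The discrete torus and its map to [l_p] *)

Section Torus.
Variables k n : nat.
Hypothesis hk : (0 < k)%N.
Definition torus : Type := {ffun 'I_n -> 'Z_(4 * k)}.
HB.instance Definition _ := GRing.Zmodule.on torus.
HB.instance Definition _ := Finite.on torus.

Definition basis_vec (i : 'I_n) : torus := [ffun j => ((j == i)%:R)%G].

Lemma torusMn (v : torus) m j : ((v *+ m)%G : torus) j = (v j *+ m)%G.
Proof. by elim: m => [|m IH]; rewrite ?GRing.mulr0n ?GRing.mulrS ffunE ?IH. Qed.

(** The clause on [j \notin l] carries the induction: as [l] has no repetition, coordinate [i] is
    still 0 when [basis_vec i] is added or subtracted. *)
Lemma signed_sum_basis (l : seq 'I_n) (s : torus) : uniq l ->
  signed_sum [seq basis_vec i | i <- l] s ->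
  forall j, (j \notin l -> s j = 0%G) /\ (s j = 0%G \/ s j = 1%G \/ s j = (- 1)%G).
Proof.
elim: l s => [|i l IH] s /=.
  by move=> _ -> j; rewrite ffunE; split=> //; left.
move=> /andP [hi hl] [t [ht hs]] j; have [h0 h1] := IH t hl ht j.
case: (eqVneq j i) => [e | ne].
  subst j; rewrite inE eqxx; split=> //.
  case: hs => [-> | [-> | ->]]; first by left; apply: h0.
    by right; left; rewrite !ffunE eqxx h0 // GRing.add0r.
  by right; right; rewrite !ffunE eqxx h0 // GRing.add0r.
have -> : s j = t j.
  case: hs => [-> | [-> | ->]] //; rewrite !ffunE (negbTE ne).
    by rewrite GRing.addr0.
  by rewrite GRing.subr0.
by rewrite inE (negbTE ne).
Qed.

Lemma val_addZ (a : 'Z_(4 * k)) m : val (a + m%:R)%G = ((a + m) %% (4 * k))%N.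
Proof.
have h1 : (1 < 4 * k)%N by lia.
by rewrite /= val_Zp_nat // [X in (_ %% X)%N]Zp_cast // modnDmr.
Qed.

Lemma waveS (a : 'Z_(4 * k)) b : wave k b (val (a + 1)%G) = wave k b (val a).+1.
Proof. by rewrite (val_addZ a 1) wave_mod addn1. Qed.

(** Coordinates [2i] and [2i + 1] hold the two phases of the wave at [x i]. *)
Definition torus_coord (s : R) (x : torus) (N : nat) : R :=
  if insub N./2 is Some i then s * INR (wave k (odd N) (val (x i))) else 0.

Lemma torus_coord_supp s x N : (n.*2 <= N)%N -> torus_coord s x N = 0.
Proof. by move=> h; rewrite /torus_coord insubN //; lia. Qed.

Lemma torus_coord_bound s x N : 0 < s -> Rabs (torus_coord s x N) <= s * INR (2 * k).
Proof.
move=> hs; rewrite /torus_coord.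
have h2 : 0 <= s * INR (2 * k) by apply: Rmult_le_pos; [lra | apply: pos_INR].
case: insubP => [i _ _|_]; last by rewrite Rabs_R0.
rewrite Rabs_right; last by apply/Rle_ge/Rmult_le_pos; [lra | apply: pos_INR].
by apply: Rmult_le_compat_l; [lra | apply: le_INR; apply/leP; apply: wave_le].
Qed.

Lemma torus_coord_step s x v N : 0 < s ->
  signed_sum [seq basis_vec i | i <- enum 'I_n] v ->
  Rabs (torus_coord s (x + v)%G N - torus_coord s x N) <= s.
Proof.
move=> hs hv; rewrite /torus_coord.
case: insubP => [i _ _|_]; last by rewrite Rminus_diag Rabs_R0; lra.
have [_ h] := signed_sum_basis _ _ (enum_uniq _) hv i.
apply: Rabs_scaled_nat_le => //.
rewrite ffunE; case: h => [-> | [-> | ->]].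
- by rewrite GRing.addr0 leq_addr.
- by rewrite waveS; apply: wave_step.
(* A backward step is a forward step starting at [x i - 1]. *)
- rewrite -[in val (x i)](GRing.subrK 1%G (x i)) waveS.
  by have [] := wave_step k (odd N) (val (x i - 1)%G) hk.
Qed.

Lemma torus_coord_antipode s x i : 0 < s ->
  exists N, s * INR k
    <= Rabs (torus_coord s (x + basis_vec i *+ 2 *+ k)%G N - torus_coord s x N).
Proof.
move=> hs; have [b h] := wave_antipode k (val (x i)) hk.
exists (i.*2 + b)%N; rewrite /torus_coord.
have e2 : ((i.*2 + b)./2 = i)%N by case: (b); lia.
have eo : odd (i.*2 + b) = b by case: (b); lia.
rewrite e2 eo valK /=.
rewrite ffunE !torusMn ffunE eqxx -GRing.mulrnA val_addZ wave_mod.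
exact: Rabs_scaled_nat_ge.
Qed.

End Torus.

(** * Contradiction with a coarse embedding *)

Theorem theorem1p3 (q : R) (p : exr) (hq : 1 <= q) (hpq : exr_gt p q)
  (X : Type) (d : X -> X -> R) (hd : is_metric d) (hbar : q_barycentric q X d) :
  ~ coarse_embeds (lp_d p) d.
Proof.
move=> [om [Om [f [[om0 omM] [[Om0 OmM] [_ [hlim hf]]]]]]].
have [c [mid [hc hmid]]] := barycentric_midpoint q X d hq hd hbar.
have hp : exr_gt p 0 by case: p hpq {f hf} => //= r; lra.
set K := Om 1; have hK : 0 <= K by apply: Om0; lra.
(* Chosen so that [c A > K^q] and [A^q >= A], against the cotype bound [c A^q <= K^q]. *)
set A := Rmax 1 (rpow K q / c + 1).
have hA1 : 1 <= A by apply: Rmax_l.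
have hA2 : rpow K q < c * A.
  have : rpow K q / c + 1 <= A by apply: Rmax_r.
  move=> h; apply: (Rlt_le_trans _ (c * (rpow K q / c + 1))).
    by field_simplify; lra.
  by apply: Rmult_le_compat_l; lra.
have hAq : A <= rpow A q.
  have := rpow_tangent q 1 A hq ltac:(lra) ltac:(lra).
  have -> : rpow 1 q = 1 by rewrite rpow_pos ?/Rpower ?ln_1 ?Rmult_0_r ?exp_0; lra.
  nra.
(* From [T] on, [om] is at least [A + 2 * K]; the scale is then chosen with [s k >= T]. *)
have [T hT] := hlim (A + 2 * K).
have [k [n [s [hk hn hs hfit hTs]]]] := exists_scale q p T hq hpq.
have hk' : 0 < INR k by apply: lt_0_INR; apply/ltP.
have hmem (x : torus k n) : lp_mem p (torus_coord k n s x).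
  apply: (finsupp_lp_mem p n.*2 (s * INR (2 * k))) => //.
  - by move=> N; apply: torus_coord_bound.
  - by move=> N; apply: torus_coord_supp.
pose F (x : torus k n) : X := f (exist _ _ (hmem x)).
have supp (x y : torus k n) N : (n.*2 <= N)%N -> torus_coord k n s x N = torus_coord k n s y N.
  by move=> h; rewrite !torus_coord_supp.
set vs := [seq basis_vec k n i | i <- enum 'I_n].
have h1 (x v : torus k n) : signed_sum vs v -> d (F (x + v)%G) (F x) <= K.
  move=> hv; have [_ h] := hf (exist _ _ (hmem (x + v)%G)) (exist _ _ (hmem x)).
  apply: (Rle_trans _ _ _ h).
  have hstep N := torus_coord_step k n hk s x v N hs hv.
  apply: OmM; last by apply: (lp_dist_le1 p n.*2 s) => //; exact: supp.
  (* Monotonicity of [Om] asks for a nonnegative distance, read off from coordinate 0. *)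
  apply: Rle_trans (lp_dist_ge_coord p n.*2 s _ _ hp hstep (supp _ _) 0%N).
  exact: Rabs_pos.
have h2 (x v : torus k n) : v \in vs -> A + 2 * K <= d (F (x + v *+ 2 *+ k)%G) (F x).
  move=> /mapP [i _ ->]; set y := (x + _)%G.
  have [h _] := hf (exist _ _ (hmem y)) (exist _ _ (hmem x)).
  apply: Rle_trans h; apply: hT.
  have [N hN] := torus_coord_antipode k n hk s x i hs.
  apply: (Rle_trans _ _ _ hTs); apply: (Rle_trans _ _ _ hN).
  (* A crude coordinate bound, enough to make the supremum finite. *)
  apply: (lp_dist_ge_coord p n.*2 (s * INR (2 * k) + s * INR (2 * k))) => //.
    move=> M; have hx := torus_coord_bound k n hk s x M hs.
    have hy := torus_coord_bound k n hk s y M hs.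
    apply: (Rle_trans _ _ _ (Rabs_triang _ _)); rewrite Rabs_Ropp.
    exact: Rplus_le_compat hy hx.
  exact: supp.
have := midpoint_cotype q c X d mid hq hd hc hmid (torus k n) F vs k A K hk ltac:(lra) hK h1 h2.
rewrite size_map size_enum_ord => h.
have e : rpow (INR k) q * rpow (A / INR k) q = rpow A q.
  rewrite -rpow_mult; first by congr rpow; field; lra.
    lra.
  by apply/Rlt_le/Rdiv_lt_0_compat; lra.
have h3 : rpow A q <= INR n * rpow (A / INR k) q.
  by rewrite -e; apply: Rmult_le_compat_r => //; apply: rpow_ge0.
(* [c A <= c A^q <= c n (A / k)^q <= K^q < c A]. *)
nra.
Qed.
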